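(* Let $\mathfrak{o}$ be a compact discrete valuation ring with residue field of cardinality $q$. Then $$\Xi_2(s)=\sum_{\Lambda\le_s\mathfrak{o}^2}[\mathfrak{o}^2:\Lambda]^{-s}=\frac{(1+q^{-s})^2}{(1-q^{-s})(1-q^{-3s+1})}.$$
   Context: $\mathfrak{o}^2$ carries componentwise multiplication; $\Lambda\le_s\mathfrak{o}^2$ means that $\Lambda$ is a finite-index $\mathfrak{o}$-submodule of $\mathfrak{o}^2$ closed under multiplication (not required to contain $(1,1)$). The identity is to be read as an identity of formal power series in $q^{-s}$ (equivalently, for $\operatorname{Re}(s)$ sufficiently large). *)

(* Defs.v *)
From HB Require Import structures.
From mathcomp Require Import all_boot all_order all_algebra.
From mathcomp Require Import finmap.
From mathcomp Require Import all_classical topology.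

Set Implicit Arguments.
Unset Strict Implicit.
Unset Printing Implicit Defensive.

Import Order.TTheory GRing.Theory Num.Theory.

Local Open Scope classical_set_scope.
Local Open Scope ring_scope.

Definition is_ideal (R : comNzRingType) (I : set R) : Prop :=
  GRing.submod_closed [in (I : set R^o)].

(* [idealr_closed] includes properness. *)
Definition is_prime_ideal (R : comNzRingType) (P : set R) : Prop :=
  idealr_closed [in P] /\ prime_idealr_closed [in P].

Definition is_pid (R : idomainType) : Prop :=
  forall I : set R, is_ideal I -> exists a : R, I = range ( *%R a).

(* [R] is a discrete valuation ring with maximal ideal [m]: a principal ideal
   domain whose unique nonzero prime ideal is [m]. *)
Definition is_dvr (R : idomainType) (m : set R) : Prop :=
  is_pid R /\
  forall P : set R, (is_prime_ideal P /\ P <> [set 0]) <-> P = m.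

(* The power [m ^ n], as the ideal generated by the products of [n] elements
   of [m]; in particular [m ^ 0] is the whole ring. *)
Definition ideal_pow (R : comNzRingType) (m : set R) (n : nat) : set R :=
  [set x | forall I : set R, is_ideal I ->
     (forall f : 'I_n -> R, (forall i, m (f i)) -> I (\prod_i f i)) -> I x].

(* The ring [R], equipped with the [m]-adic topology. *)
Definition adic (R : comNzRingType) (m : set R) : Type := R.

Definition adic_open (R : comNzRingType) (m : set R) (U : set R) : Prop :=
  forall x, U x -> exists n, [set x + y | y in ideal_pow m n] `<=` U.

Lemma ideal_powS (R : comNzRingType) (m : set R) (n : nat) :
  ideal_pow m n.+1 `<=` ideal_pow m n.
Proof.
move=> x xm I II If; apply: xm => // f mf; rewrite big_ord_recl.
have := If (fun i => f (lift ord0 i)) (fun i => mf _).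
move: II => [I0 Il] /mem_set Ip; apply/set_mem; rewrite -[_ * _]addr0.
exact: (Il (f ord0) _ _ Ip I0).
Qed.

Lemma ideal_pow_le (R : comNzRingType) (m : set R) (n p : nat) :
  (n <= p)%N -> ideal_pow m p `<=` ideal_pow m n.
Proof.
move=> /subnK <-; elim: (p - n)%N => [//|k IHk] x.
by rewrite addSn => /ideal_powS /IHk.
Qed.

Section AdicTopology.
Context (R : comNzRingType) (m : set R).

HB.instance Definition _ := Choice.copy (adic m) R.

Let openT : adic_open m setT.
Proof. by move=> x _; exists 0%N. Qed.

Let openI : setI_closed (adic_open m).
Proof.
move=> U V oU oV x [/oU[n nU] /oV[p pV]]; exists (maxn n p).
by move=> _ [y my <-]; split; [apply: nU | apply: pV]; exists y => //;
  apply: ideal_pow_le my; rewrite (leq_maxl, leq_maxr).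
Qed.

Let open_bigU (I : Type) (f : I -> set R) :
  (forall i, adic_open m (f i)) -> adic_open m (\bigcup_i f i).
Proof.
move=> of_ x [i _ /of_[n nf]]; exists n => y /nf fy.
by exists i.
Qed.

HB.instance Definition _ := isOpenTopological.Build (adic m)
  openT openI open_bigU.

End AdicTopology.

Definition cosets (V : zmodType) (L : set V) : set (set V) :=
  range (fun x : V => [set x + y | y in L]).

(* Meaningful only when [cosets L] is finite. *)
Definition coset_index (V : zmodType) (L : set V) : nat :=
  #|` fset_set (cosets L)|.

(* [L <=_s R^2]; [1 \in L] is not required. *)
Definition is_subalgebra2 (R : comNzRingType) (L : set (R^o * R^o)) : Prop :=
  [/\ GRing.submod_closed [in L], GRing.mulr_2closed [in L]
    & finite_set (cosets L)].

(* Formal power series in [t = q^-s] are given by their coefficients. *)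
Definition fps : Type := nat -> rat.

Definition fps_of_poly (p : {poly rat}) : fps := fun n => p`_n.

Definition fps_mul (f g : fps) : fps :=
  fun n => \sum_(i < n.+1) f i * g (n - i)%N.

(* First [n] coefficients of the quotient [f / g], by long division. *)
Fixpoint fps_div_seq (f g : fps) (n : nat) : seq rat :=
  if n is k.+1 then
    let s := fps_div_seq f g k in
    rcons s ((f k - \sum_(i < k) s`_i * g (k - i)%N) / g 0%N)
  else [::].

Definition fps_div (f g : fps) : fps := fun n => (fps_div_seq f g n.+1)`_n.

Lemma size_fps_div_seq f g n : size (fps_div_seq f g n) = n.
Proof. by elim: n => //= n IHn; rewrite size_rcons IHn. Qed.

Lemma nth_fps_div_seq f g n i :
  (i < n)%N -> (fps_div_seq f g n)`_i = fps_div f g i.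
Proof.
elim: n => // n IHn; rewrite ltnS leq_eqVlt => /predU1P[->//|lt_in].
by rewrite /= nth_rcons size_fps_div_seq lt_in IHn.
Qed.

Lemma fps_divK (f g : fps) : g 0%N != 0 -> fps_mul (fps_div f g) g = f.
Proof.
move=> g0; apply/funext => n; rewrite /fps_mul big_ord_recr /= subnn.
rewrite {2}/fps_div /= nth_rcons size_fps_div_seq ltnn eqxx divfK //.
rewrite addrC -[RHS](subrK (\sum_(i < n) fps_div f g i * g (n - i)%N)).
congr (_ - _ + _); apply: eq_bigr => i _.
by rewrite nth_fps_div_seq.
Qed.

(* [n ^ -s] as a power series in [q^-s]: it is [t^k] when [n = q^k]. It is
   meaningful only when [1 < q] and [n] is a power of [q]. *)
Definition pow_Ns (q n : nat) : fps := fun k => (n == (q ^ k)%N)%:R.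

(* The sum is taken coefficientwise; [\sum_(_ \in _)] is the sum over the
   support when the latter is finite, and [0] otherwise. *)
Definition Xi2 (R : comNzRingType) (q : nat) : fps := fun k =>
  \sum_(L \in [set L : set (R^o * R^o) | is_subalgebra2 L])
    pow_Ns q (coset_index L) k.

(* Main.v *)
(** A finite-index submodule of [R^2] has a unique Hermite normal form: it is
    generated by [(p^i, b)] and [(0, p^j)], with [p] a uniformizer and [b] taken
    modulo [p^j]; its index is [q^(i+j)]. As
    [(p^i, b)^2 - p^i (p^i, b) = (0, b (b - p^i))], it is closed under
    multiplication iff [p^j] divides [b (b - p^i)]. Let [N(i, j)] be the number
    of such [b]. If [p^(j+2)] divides [b (b - p^(i+1))] then [b = p c], and the
    condition becomes that [p^j] divides [c (c - p^i)], with [c] taken modulo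
    [p^(j+1)]; hence [N(i+1, j+2) = q N(i, j)]. Together with
    [N(i, 0) = N(i+1, 1) = 1] and [N(0, j+1) = 2] (idempotents of [R/p^(j+1)]),
    this gives [a(n+3) = q a(n) + 4] for [a(n)], the sum of the [N(i, n-i)],
    which is the recurrence satisfied by the coefficients of the quotient. *)

Require Import Defs.
From HB Require Import structures.
From mathcomp Require Import all_boot all_order all_algebra.
From mathcomp Require Import finmap ring.
From mathcomp Require Import all_classical topology.

Set Implicit Arguments.
Unset Strict Implicit.
Unset Printing Implicit Defensive.

Import Order.TTheory GRing.Theory Num.Theory.

Local Open Scope classical_set_scope.
Local Open Scope ring_scope.

(** * Transversals of a subgroup and its index *)

Section Transversal.
Context (V : zmodType).
Implicit Types (L : set V) (S T : seq V).

(** Representatives form a sequence, so that an index is a [size] and a number of residues with a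
    given property is a [count]. *)
Definition is_transversal_mod L S : Prop :=
  [/\ uniq S, forall x, exists2 s, s \in S & L (x - s)
    & {in S &, forall r s, L (r - s) -> r = s}].

Definition is_subgroup L : Prop := L 0 /\ forall x y, L x -> L y -> L (x - y).

Lemma subgroupN L x : is_subgroup L -> L x -> L (- x).
Proof. by move=> [L0 LB] Lx; rewrite -sub0r; apply: LB. Qed.

Lemma subgroup_subC L x y : is_subgroup L -> L (x - y) -> L (y - x).
Proof. by move=> sL /(subgroupN sL); rewrite opprB. Qed.

Lemma subgroup_trans L y x z :
  is_subgroup L -> L (x - y) -> L (y - z) -> L (x - z).
Proof.
move=> sL Lxy /(subgroup_subC sL) Lzy.
by have := sL.2 _ _ Lxy Lzy; rewrite opprB addrA subrK.
Qed.

Lemma coset_eqP L x y : is_subgroup L ->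
  [set x + z | z in L] = [set y + z | z in L] <-> L (x - y).
Proof.
move=> sL; split=> [xy|Lxy].
  have : [set y + z | z in L] x by rewrite -xy; exists 0; [case: sL|rewrite addr0].
  by case=> z Lz <-; rewrite addrC addKr.
wlog suff sub : x y Lxy / [set x + z | z in L] `<=` [set y + z | z in L].
  by apply/seteqP; split; apply: sub => //; apply: subgroup_subC.
move=> _ [z Lz <-]; exists (x - y + z); last by rewrite addrA addrC subrKC addrC.
by rewrite -[z]opprK; apply: sL.2 => //; apply: subgroupN.
Qed.

Lemma cosets_transversal L S : is_subgroup L -> is_transversal_mod L S ->
  cosets L = [set` [seq [set s + z | z in L] | s <- S]].
Proof.
move=> sL [_ surS _]; apply/seteqP; split=> [_ [x _ <-]|X] /=.
  have [s sS Lxs] := surS x; apply/mapP; exists s => //.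
  exact/coset_eqP.
by move=> /mapP[s _ ->]; exists s.
Qed.

Lemma finite_cosets_transversal L S :
  is_subgroup L -> is_transversal_mod L S -> finite_set (cosets L).
Proof. by move=> sL LS; rewrite (cosets_transversal sL LS); exact: finite_seq. Qed.

Lemma coset_index_transversal L S :
  is_subgroup L -> is_transversal_mod L S -> coset_index L = size S.
Proof.
move=> sL LS; have [uS _ injS] := LS.
rewrite /coset_index (cosets_transversal sL LS) -(size_map (fun s => [set s + z | z in L])).
set X := map _ S.
have uX : uniq X.
  by rewrite map_inj_in_uniq// => r s rS sS /(coset_eqP _ _ sL); apply: injS.
(* The size of [undup X] is the cardinal of the finite set of elements of [X]; what remains is an
   equality of finite sets. *)
rewrite -(undup_id uX) -card_fseq; congr #|` _|.
apply/fsetP => A; rewrite in_fset_set ?finite_seq//=.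
apply/idP/idP => [/set_mem|AX]; first by rewrite /= mem_undup in_fset.
by apply/mem_set; rewrite /= mem_undup; rewrite in_fset in AX.
Qed.

Lemma transversal_exists L : is_subgroup L -> finite_set (cosets L) ->
  exists S, is_transversal_mod L S.
Proof.
move=> sL finL.
(* [f] picks a point in each coset; its value elsewhere is a dummy 0. *)
have /choice[f fP] : forall X : set V, exists x, cosets L X -> X = [set x + z | z in L].
  by move=> X; case: (pselect (cosets L X)) => [[x _ <-]|nX]; [exists x|exists 0].
have mem X : X \in fset_set (cosets L) = (X \in cosets L) by rewrite in_fset_set.
exists [seq f X | X <- fset_set (cosets L)]; split=> [|x|].
- rewrite map_inj_in_uniq ?fset_uniq// => X Y; rewrite !mem => /set_mem cX /set_mem cY.
  by move=> fXY; rewrite (fP _ cX) (fP _ cY) fXY.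
- have cx : cosets L [set x + z | z in L] by exists x.
  exists (f [set x + z | z in L]); last exact/(coset_eqP _ _ sL)/fP.
  by apply: map_f; rewrite mem inE.
- move=> _ _ /mapP[X + ->] /mapP[Y + ->]; rewrite !mem => /set_mem cX /set_mem cY.
  by move=> /(coset_eqP _ _ sL) fXY; rewrite (fP _ cX) (fP _ cY) fXY.
Qed.

(** Sending an element of [T] to the representative of its class in [S] is a bijection from [T] to
    [S], and it preserves [P]. Residues can therefore be counted on whichever transversal is
    convenient. *)
Lemma count_transversal L S T (P : pred V) : is_subgroup L ->
  is_transversal_mod L S -> is_transversal_mod L T ->
  (forall x y, L (x - y) -> P x = P y) -> count P S = count P T.
Proof.
move=> sL [uS surS injS] [uT surT injT] invP.
have /choice[f fP] : forall x, exists s, s \in S /\ L (x - s).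
  by move=> x; have [s] := surS x; exists s.
have fL x y : L (x - y) -> f x = f y.
  move=> Lxy; have [[fxS Lx] [fyS Ly]] := (fP x, fP y).
  apply: injS => //; apply: (subgroup_trans sL) (Ly).
  by apply: (subgroup_trans sL) Lxy; apply: (subgroup_subC sL).
have pf : perm_eq S (map f T).
  apply: uniq_perm => // [|s].
    rewrite map_inj_in_uniq// => r s rT sT frs.
    apply: injT => //; have [[_ Lr] [_ Ls]] := (fP r, fP s).
    by apply: (subgroup_trans sL) Lr _; rewrite frs; apply: (subgroup_subC sL).
  apply/idP/mapP => [sS|[t tT ->]]; last by case: (fP t).
  have [t tT Lst] := surT s; exists t => //; have [ftS Lt] := fP t.
  by apply: injS => //; apply: (subgroup_trans sL) Lst Lt.
rewrite (permP pf) count_map; apply: eq_count => x /=.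
by apply/esym/invP; case: (fP x).
Qed.

(** Serves to evaluate a count once the condition is known to cut out a union of explicit
    classes. *)
Lemma count_transversal_class L S x : is_subgroup L -> is_transversal_mod L S ->
  count (fun s => `[< L (s - x) >]) S = 1%N.
Proof.
move=> sL [uS surS injS]; have [s sS /(subgroup_subC sL) Lsx] := surS x.
have -> : 1%N = (s \in S) by rewrite sS.
rewrite -(count_uniq_mem _ uS); apply: eq_in_count => r rS /=.
apply/asboolP/eqP => [Lrx|->//]; apply: injS => //.
by apply: (subgroup_trans sL) Lrx _; apply: (subgroup_subC sL).
Qed.

Lemma transversal_shift L S d :
  is_transversal_mod L S -> is_transversal_mod L [seq s + d | s <- S].
Proof.
move=> [uS surS injS]; split=> [|x|_ _ /mapP[r rS ->] /mapP[s sS ->]].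
- by rewrite map_inj_uniq//; exact: addIr.
- have [s sS Ls] := surS (x - d); exists (s + d); first exact: map_f.
  by rewrite opprD addrA addrAC.
- by rewrite opprD addrACA subrr addr0 => /(injS _ _ rS sS) ->.
Qed.

End Transversal.

(** * Principal ideals, prime ideals and the existence of a uniformizer *)

Definition pideal (R : comNzRingType) (a : R) : set R := range ( *%R a).

Lemma pidealM (R : comNzRingType) (a b : R) : pideal a (a * b).
Proof. by exists b. Qed.

Lemma pideal_subgroup (R : comNzRingType) (a : R) : is_subgroup (pideal a).
Proof.
split=> [|_ _ [x _ <-] [y _ <-]]; first by exists 0; rewrite ?mulr0.
by exists (x - y); rewrite ?mulrBr.
Qed.

Lemma pideal_linear (R : comNzRingType) (a b x y : R) :
  pideal a x -> pideal a y -> pideal a (b * x + y).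
Proof. by move=> [u _ <-] [v _ <-]; exists (b * u + v) => //; ring. Qed.

Lemma pideal_mull (R : comNzRingType) (a b x : R) : pideal a x -> pideal a (b * x).
Proof. by move=> [u _ <-]; exists (b * u) => //; rewrite mulrCA. Qed.

Lemma pideal_mulr (R : comNzRingType) (a b x : R) : pideal a x -> pideal a (x * b).
Proof. by rewrite mulrC; exact: pideal_mull. Qed.

(** The content of [is_ideal], free of boolean membership. *)
Definition is_linear_subset (R : comNzRingType) (I : set R) : Prop :=
  I 0 /\ forall a x y, I x -> I y -> I (a * x + y).

(** By Zorn's lemma there is a maximal element among the ideals that contain [x] and avoid 1;
    maximality makes it prime. *)
Lemma exists_prime_ideal (R : comUnitRingType) (x : R) :
  x \isn't a GRing.unit -> exists2 P : set R, is_prime_ideal P & P x.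
Proof.
move=> xNunit.
pose proper_over (X : set R) := [/\ is_linear_subset X, X x & ~ X 1].
(* [set0] is admitted because [Zorn_bigcup] includes the empty chain. *)
have [|A [PA maxA]] := @Zorn_bigcup R (fun X => X = set0 \/ proper_over X).
  move=> F FP totF; have [F0|] := pselect (forall X, F X -> X = set0).
    by left; apply: bigcup0.
  move=> /existsNP[X /not_implyP[FX X0]]; right.
  have [//|[[XC0 _] Xx _]] := FP _ FX.
  split; [split|by exists X|].
  - by exists X.
  - move=> a u v [Y FY Yu] [Z FZ Zv]; have [YZ|ZY] := totF _ _ FY FZ.
      have [Z0|[[_ Zlin] _ _]] := FP _ FZ; first by rewrite Z0 in Zv.
      by exists Z => //; apply: Zlin => //; apply: YZ.
    have [Y0|[[_ Ylin] _ _]] := FP _ FY; first by rewrite Y0 in Yu.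
    by exists Y => //; apply: Ylin => //; apply: ZY.
  - by move=> [Y FY Y1]; have [Y0|[]//] := FP _ FY; rewrite Y0 in Y1.
have maxA' B : proper_over B -> A `<=` B -> B `<=` A.
  move=> PB AB; have := maxA B; rewrite properEneq => nAB.
  have [->//|/eqP neqAB] := eqVneq A B.
  by case: nAB; [split=> //; apply/eqP|right].
(* The maximal element is not the empty set: the ideal generated by the non-unit [x] is strictly
   larger. *)
have [A0|[[AC0 Alin] Ax A1]] := PA.
  have : proper_over (pideal x).
    split; first by split; [case: (pideal_subgroup x)|move=> *; exact: pideal_linear].
    - by exists 1; rewrite ?mulr1.
    - move=> [y _ xy1]; move/negP: xNunit; apply; apply/unitrP; exists y.
      by rewrite mulrC xy1.
  move=> /[dup] Px /maxA'; rewrite A0 => /(_ (@sub0set _ _)) x0.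
  by case: Px => _ /x0.
exists A => //; split; first split.
- exact/mem_set.
- by apply/negP => /set_mem.
- by move=> a u v /set_mem Au /set_mem Av; apply/mem_set/Alin.
move=> u v /set_mem Auv; apply/orP; have [Au|nAu] := pselect (A u).
  by left; apply/mem_set.
right; apply/mem_set.
(* [B] is the ideal [A + (u)]. As [u] is not in [A], maximality forces [1 = r * u + a]; multiplying
   by [v] puts [v] in [A], because [u * v] is there. *)
pose B := [set z | exists r a, A a /\ z = r * u + a].
have AB : A `<=` B by move=> a Aa; exists 0, a; rewrite mul0r add0r.
have Bu : B u by exists 1, 0; rewrite mul1r addr0.
have : B 1.
  apply: contrapT => B1; apply: nAu; apply: (maxA' B) => //; split=> //.
    split; first exact: AB.
    move=> a _ _ [r [b [Ab ->]]] [s [c [Ac ->]]].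
    exists (a * r + s), (a * b + c); split; first exact: Alin.
    by ring.
  exact: AB.
move=> [r [a [Aa /(congr1 ( *%R v))]]]; rewrite mulr1 => ->.
have -> : v * (r * u + a) = r * (u * v) + (v * a + 0) by ring.
exact: (Alin r _ _ Auv (Alin v _ _ Aa AC0)).
Qed.

(* This also says that [R] is local, with maximal ideal generated by [p]. *)
Definition is_uniformizer (R : comUnitRingType) (p : R) : Prop :=
  p != 0 /\ forall x, x \is a GRing.unit <-> ~ pideal p x.

(** The generator of [m] works: a nonzero non-unit lies in some prime ideal, which is then nonzero,
    hence equal to [m]. *)
Lemma dvr_uniformizer (R : idomainType) (m : set R) :
  is_dvr m -> exists2 p : R, m = pideal p & is_uniformizer p.
Proof.
move=> [pidR primeR]; have [[m_ideal _] m0] := (primeR m).2 erefl.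
have [/set_mem mC0 /negP m1 mlin] := m_ideal.
have [p mp] : exists p, m = pideal p.
  by apply: pidR; split=> [|a u v um vm]; [exact/mem_set|exact: mlin].
exists p => //; split.
  apply/eqP => p0; apply: m0; rewrite mp p0; apply/seteqP; split=> [_ [y _ <-]|_ ->].
    by rewrite mul0r.
  by exists 0; rewrite ?mulr0.
move=> x; split=> [xU|]; last first.
  move=> npx; apply: contrapT => /negP /exists_prime_ideal[P primeP Px].
  have [x0|x0] := eqVneq x 0; first by apply: npx; rewrite x0 -mp.
  apply: npx; rewrite -mp; suff <- : P = m by [].
  by apply/primeR; split=> // P0; rewrite P0 in Px; move/eqP: x0.
rewrite -mp => mx; apply: m1.
by rewrite -(mulVr xU) -[_ * _]addr0; apply: mlin; apply/mem_set.
Qed.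

(** * Divisibility by powers of a uniformizer *)

Section Uniformizer.
Context (R : idomainType) (p : R) (p_unif : is_uniformizer p).

Let p_neq0 : p != 0. Proof. by case: p_unif. Qed.

Let ppow_neq0 i : p ^+ i != 0. Proof. exact: expf_neq0. Qed.

Lemma uniformizer_Nunit x : pideal p x -> x \isn't a GRing.unit.
Proof. by move=> px; apply/negP => /p_unif.2. Qed.

Lemma uniformizer_unitP x : x \is a GRing.unit \/ exists y, x = p * y.
Proof.
have [[y _ <-]|npx] := pselect (pideal p x); first by right; exists y.
by left; apply/p_unif.2.
Qed.

Lemma uniformizer_prime x y : pideal p (x * y) -> pideal p x \/ pideal p y.
Proof.
move=> /uniformizer_Nunit; rewrite unitrM negb_and => /orP[] nU; [left|right];
  by apply: contrapT => /p_unif.2 U; rewrite U in nU.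
Qed.

Lemma pideal_powM i x y : pideal (p ^+ i * x) (p ^+ i * y) <-> pideal x y.
Proof.
split=> [[z _]|[z _ <-]]; last by exists z; rewrite ?mulrA.
by rewrite -mulrA => /(mulfI (ppow_neq0 i)) <-; exists z.
Qed.

Lemma pideal_powD i j x : pideal (p ^+ (i + j)) (p ^+ i * x) <-> pideal (p ^+ j) x.
Proof. by rewrite exprD; exact: pideal_powM. Qed.

Lemma pideal_pow0 x : pideal (p ^+ 0) x.
Proof. by exists x; rewrite ?expr0 ?mul1r. Qed.

(** If [j < i], cancelling [p ^+ j] would make [p] divide 1. *)
Lemma pideal_pow_pow i j : pideal (p ^+ i) (p ^+ j) -> (i <= j)%N.
Proof.
move=> [x _ pij]; rewrite leqNgt; apply/negP => ji.
have := uniformizer_Nunit (pidealM p (p ^+ (i - j).-1 * x)).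
rewrite mulrA -exprS prednK ?subn_gt0// => /negP; apply.
suff -> : p ^+ (i - j) * x = 1 by rewrite unitr1.
by apply: (mulfI (ppow_neq0 j)); rewrite mulrA -exprD subnKC 1?ltnW// mulr1.
Qed.

Lemma uniformizer_unit1B k : (0 < k)%N -> 1 - p ^+ k \is a GRing.unit.
Proof.
case: k => // k _; apply/p_unif.2 => p1.
have /uniformizer_Nunit/negP[] : pideal p 1.
  rewrite -(subrK (p ^+ k.+1) 1) -[1 - _]mul1r; apply: pideal_linear => //.
  by rewrite exprS; apply: pidealM.
exact: unitr1.
Qed.

(** Take the least [i] with [p ^+ i] in [I]. If [p ^+ k * y] is in [I] with [k < i], then [y] is not
    a unit, since otherwise [p ^+ k] would be in [I]; so [p] divides [y], and [k] can be raised up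
    to [i]. *)
Lemma ideal_containing_pow (I : set R) n :
  is_linear_subset I -> I (p ^+ n) -> exists i, I = pideal (p ^+ i).
Proof.
move=> [I0 Ilin] In; have exI : exists k, `[< I (p ^+ k) >].
  by exists n; apply/asboolP.
case: (ex_minnP exI) => i /asboolP Ii mini; exists i; apply/seteqP; split=> x.
  move=> Ix; suff: forall k, (k <= i)%N -> pideal (p ^+ k) x by apply.
  elim=> [_|k IHk ki]; first exact: pideal_pow0.
  have [y _ xy] := IHk (ltnW ki); rewrite -xy -addn1.
  apply/pideal_powD; rewrite expr1; apply: contrapT => /p_unif.2 yU.
  suff: (i <= k)%N by rewrite leqNgt ki.
  apply/mini/asboolP; have := Ilin y^-1 _ _ Ix I0.
  by rewrite addr0 -xy mulrCA mulVr// mulr1.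
by move=> [y _ <-]; have := Ilin y _ _ Ii I0; rewrite addr0 mulrC.
Qed.

Lemma transversal_pow0 : is_transversal_mod (pideal (p ^+ 0)) [:: 0].
Proof.
split=> // [x|r s].
  by exists 0; [rewrite inE|exact: pideal_pow0].
by rewrite !inE => /eqP-> /eqP->.
Qed.

(** As in a [p]-adic expansion, a residue modulo [p ^+ (i + j)] consists of its [i] lowest digits,
    given by [S], and the next [j], given by [T]. *)
Lemma transversal_powD i j S T :
  is_transversal_mod (pideal (p ^+ i)) S ->
  is_transversal_mod (pideal (p ^+ j)) T ->
  is_transversal_mod (pideal (p ^+ (i + j))) [seq s + p ^+ i * t | s <- S, t <- T].
Proof.
move=> [uS surS injS] [uT surT injT].
have inj s t s' t' : s \in S -> s' \in S -> t \in T -> t' \in T ->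
    pideal (p ^+ (i + j)) (s + p ^+ i * t - (s' + p ^+ i * t')) ->
    s = s' /\ t = t'.
  move=> sS sS' tT tT' H.
  (* The low digits agree because the two sums are congruent modulo [p ^+ i]; the high digits then
     agree after division by [p ^+ i]. *)
  have ss : s = s'.
    apply: injS => //; have [z _ Hz] := H; rewrite exprD in Hz.
    by exists (p ^+ j * z - t + t') => //; rewrite mulrDr mulrBr mulrA Hz; ring.
  split=> //; apply: injT => //; apply/(pideal_powD i).
  by move: H; rewrite ss; congr (pideal _ _); ring.
split=> [|x|_ _ /allpairsP[[s t] /= [sS tT ->]] /allpairsP[[s' t'] /= [sS' tT' ->]]].
- apply: allpairs_uniq => // -[s t] [s' t'] /allpairsP[[a b] /= [aS bT [-> ->]]].
  move=> /allpairsP[[a' b'] /= [aS' bT' [-> ->]]] E.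
  have [//|-> ->//] := inj a b a' b' aS aS' bT bT'.
  by rewrite E subrr; case: (pideal_subgroup (p ^+ (i + j))).
- have [s sS [y _ xs]] := surS x; have [t tT yt] := surT y.
  exists (s + p ^+ i * t); first by apply/allpairsP; exists (s, t).
  have -> : x - (s + p ^+ i * t) = p ^+ i * (y - t) by rewrite mulrBr xs; ring.
  exact/pideal_powD.
- by move=> /inj[]// -> ->.
Qed.

End Uniformizer.

(** * Counting the residues [b] with [p ^+ j] dividing [b * (b - p ^+ i)] *)

Lemma count_allpairs (A B C : Type) (P : pred C) (f : A -> B -> C) s t :
  count P [seq f x y | x <- s, y <- t] =
  (\sum_(x <- s) count (fun y => P (f x y)) t)%N.
Proof.
by elim: s => [|x s IHs]; rewrite ?big_nil// big_cons /= count_cat IHs count_map.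
Qed.

Section GoodCount.
Context (R : idomainType) (p : R) (p_unif : is_uniformizer p).

(* The condition for [(p^i, b)] and [(0, p^j)] to generate a subalgebra. *)
Definition is_good i j (b : R) : bool := `[< pideal (p ^+ j) (b * (b - p ^+ i)) >].

(** The values of the polynomial [X * (X - p ^+ i)] at [b] and [c] differ by a multiple of
    [b - c]. *)
Lemma is_good_mod i j b c : pideal (p ^+ j) (b - c) -> is_good i j b = is_good i j c.
Proof.
wlog suff impl : b c / pideal (p ^+ j) (b - c) -> is_good i j c -> is_good i j b.
  by move=> bc; apply/idP/idP; apply: impl => //;
    apply: subgroup_subC => //; exact: pideal_subgroup.
move=> [y _ bc] /asboolP goodc; apply/asboolP.
have -> : b * (b - p ^+ i) = (b + c - p ^+ i) * (b - c) + c * (c - p ^+ i) by ring.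
by apply: pideal_linear => //; exists y.
Qed.

(** The prime [p] divides [b] or [b - p ^+ i.+1], and these are congruent modulo [p]. *)
Lemma is_good_pideal i j b : is_good i.+1 j.+1 b -> pideal p b.
Proof.
move=> /asboolP; rewrite exprS => -[x _]; rewrite -mulrA => good_b.
have [//|[y _ py]] : pideal p b \/ pideal p (b - p ^+ i.+1).
  by apply: uniformizer_prime => //; rewrite -good_b; apply: pidealM.
by exists (y + p ^+ i) => //; rewrite mulrDr py -exprS subrK.
Qed.

Lemma is_goodSS i j b : is_good i.+1 j.+2 (p * b) = is_good i j b.
Proof.
have -> : is_good i.+1 j.+2 (p * b) =
    `[< pideal (p ^+ (2 + j)) (p ^+ 2 * (b * (b - p ^+ i))) >].
  by congr `[< pideal _ _ >]; rewrite exprS; ring.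
by apply/asboolP/asboolP; rewrite pideal_powD.
Qed.

(** The count is made on the transversal of all [r + p * (s + p ^+ j * t)], with [r] and [t] modulo
    [p] and [s] modulo [p ^+ j]. Only [r = 0] contributes, and then goodness depends on [s] alone;
    the free digit [t] gives the factor [size S1]. *)
Lemma count_goodSS i j S S1 T : is_transversal_mod (pideal p) S1 ->
  is_transversal_mod (pideal (p ^+ j)) S ->
  is_transversal_mod (pideal (p ^+ j.+2)) T ->
  count (is_good i.+1 j.+2) T = (size S1 * count (is_good i j) S)%N.
Proof.
move=> trS1 trS trT; have [_ surS1 _] := trS1.
have [c cS1 /(subgroup_subC (pideal_subgroup p))] := surS1 0; rewrite subr0 => pc.
(* Shifting makes [0] the representative of its class, so that [p] divides no
   other element of [S0]. *)
pose S0 := [seq s + - c | s <- S1].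
have trS0 : is_transversal_mod (pideal p) S0 by exact: transversal_shift.
have [uS0 _ injS0] := trS0.
have S00 : 0 \in S0 by apply/mapP; exists c; rewrite ?subrr.
rewrite -[p]expr1 in trS0; rewrite -[p]expr1 in trS1.
have trT' := transversal_powD p_unif trS trS1; rewrite addn1 in trT'.
have := transversal_powD p_unif trS0 trT'; rewrite expr1 add1n.
set S' := [seq s + p ^+ j * t | s <- S, t <- S1] => trT''.
rewrite (count_transversal (pideal_subgroup _) trT trT''); last first.
  by move=> x y; exact: is_good_mod.
(* For a nonzero leading digit [s] of [S0], a good [s + p * x] would be divisible by [p], and so
   would [s]. *)
rewrite count_allpairs (bigD1_seq 0)//= big_seq_cond big1 ?addn0; last first.
  move=> s /andP[sS0 s0]; apply/eqP; rewrite -leqn0 leqNgt -has_count.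
  apply/hasPn => x _; apply/negP => /is_good_pideal [y _ py].
  move/eqP: s0; apply; apply: injS0 => //; exists (y - x) => //.
  by rewrite mulrBr py subr0 addrK.
under eq_count => x do rewrite add0r is_goodSS.
rewrite count_allpairs; transitivity (\sum_(x <- S) (size S1 * is_good i j x))%N.
  apply: eq_bigr => x _; rewrite (@eq_count _ _ (fun=> is_good i j x)).
    by case: is_good; rewrite ?count_predT ?count_pred0 ?muln1 ?muln0.
  move=> y; apply: is_good_mod; rewrite addrAC subrr add0r; exact: pidealM.
by rewrite -big_distrr /= -sumn_count sumnE big_map.
Qed.

Lemma count_good_pow0 i S :
  is_transversal_mod (pideal (p ^+ 0)) S -> count (is_good i 0) S = 1%N.
Proof.
move=> trS; rewrite -[RHS](count_transversal_class 0 (pideal_subgroup _) trS).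
by apply: eq_count => x; apply/asboolP/asboolP => _; exact: pideal_pow0.
Qed.

(** Here the good residues form the class of 0 modulo [p]. *)
Lemma count_good_pow1 i S :
  is_transversal_mod (pideal (p ^+ 1)) S -> count (is_good i.+1 1) S = 1%N.
Proof.
move=> trS; rewrite -[RHS](count_transversal_class 0 (pideal_subgroup _) trS).
apply: eq_count => x; apply/idP/asboolP => [/(@is_good_pideal i 0)|]; rewrite expr1 subr0//.
by move=> px; apply/asboolP; rewrite expr1; apply: pideal_mulr.
Qed.

(** One of [b] and [b - 1] is a unit, so [p ^+ j.+1] divides [b * (b - 1)] only if it divides the
    other factor. The good residues are thus the classes of 0 and 1. *)
Lemma count_good_0S j S :
  is_transversal_mod (pideal (p ^+ j.+1)) S -> count (is_good 0 j.+1) S = 2%N.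
Proof.
move=> trS; have sL := pideal_subgroup (p ^+ j.+1).
rewrite -[2%N]/(1 + 1)%N -[X in (_ = X + _)%N](count_transversal_class 0 sL trS).
rewrite -[X in (_ = _ + X)%N](count_transversal_class 1 sL trS) -count_predUI.
(* The two classes are disjoint, as [p] does not divide 1. *)
rewrite [X in (_ + X)%N](_ : _ = 0)%N ?addn0; last first.
  apply/eqP; rewrite -leqn0 leqNgt -has_count; apply/hasPn => x _.
  apply/negP => /andP[/asboolP x0 /asboolP x1].
  have := sL.2 _ _ x0 x1; rewrite subr0 opprB addrC subrK => H.
  have /uniformizer_Nunit/negP[//|] : pideal p 1.
    by case: H => y _ <-; rewrite exprS -mulrA; apply: pidealM.
  exact: unitr1.
apply: eq_count => x; rewrite /= /is_good expr0 subr0.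
apply/asboolP/orP => [H|[]/asboolP]; last 2 first.
- exact: pideal_mulr.
- exact: pideal_mull.
have [xU|[y xy]] := uniformizer_unitP p_unif x.
  by right; apply/asboolP; have := pideal_mull x^-1 H; rewrite mulKr.
have [x1U|] := uniformizer_unitP p_unif (x - 1).
  by left; apply/asboolP; have := pideal_mulr (x - 1)^-1 H; rewrite mulrK.
move=> [z xz]; have /(uniformizer_Nunit p_unif)/negP[] : pideal p 1.
  by exists (y - z) => //; rewrite mulrBr -xy -xz opprB addrC subrK.
exact: unitr1.
Qed.

End GoodCount.

(** * Submodules of the plane in Hermite normal form *)

Section HermiteLattice.
Context (R : idomainType) (p : R) (p_unif : is_uniformizer p).
Local Notation R2 := (R^o * R^o)%type.
Implicit Types (i j : nat) (b : R) (L : set R2).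

Definition hermite_lattice i j b : set R2 :=
  [set v | exists x y : R, v = (p ^+ i * x, b * x + p ^+ j * y)].

Lemma hermite_lattice_submod i j b :
  GRing.submod_closed [in hermite_lattice i j b].
Proof.
split; first by apply/mem_set; exists 0, 0; rewrite !mulr0 addr0.
move=> a _ _ /set_mem[x [y ->]] /set_mem[z [t ->]]; apply/mem_set.
by exists (a * x + z), (a * y + t); congr pair; rewrite /= /GRing.scale /=; ring.
Qed.

Lemma hermite_lattice_subgroup i j b : is_subgroup (hermite_lattice i j b).
Proof.
have [/set_mem H0 Hlin] := hermite_lattice_submod i j b; split=> // v w Hv Hw.
by rewrite addrC -scaleN1r; apply/set_mem/Hlin; apply/mem_set.
Qed.

Lemma hermite_lattice_gen1 i j b : hermite_lattice i j b (p ^+ i, b).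
Proof. by exists 1, 0; rewrite !mulr1 mulr0 addr0. Qed.

Lemma hermite_lattice_snd i j b y :
  hermite_lattice i j b (0, y) <-> pideal (p ^+ j) y.
Proof.
split=> [[x [z [/esym/eqP]]]|[z _ <-]]; last by exists 0, z; rewrite !mulr0 add0r.
rewrite mulf_eq0 expf_eq0 (negbTE p_unif.1) andbF /= => /eqP-> ->.
by rewrite mulr0 add0r; apply: pidealM.
Qed.

Lemma hermite_lattice_mul i j b :
  GRing.mulr_2closed [in hermite_lattice i j b] <-> is_good p i j b.
Proof.
split=> [mulL|/asboolP[c _ bc]].
  have g1 := mem_set (hermite_lattice_gen1 i j b).
  have /set_mem b2 := mulL _ _ g1 g1.
  have [_ /(_ (- p ^+ i) _ _ g1 (mem_set b2))/set_mem] := hermite_lattice_submod i j b.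
  rewrite (_ : _ + _ = (0, b * (b - p ^+ i))); first by move/hermite_lattice_snd/asboolP.
  by congr pair; rewrite /= /GRing.scale /=; ring.
move=> _ _ /set_mem[x [y ->]] /set_mem[z [t ->]]; apply/mem_set.
(* In the second coordinate [b ^+ 2] is replaced by [p ^+ i * b + p ^+ j * c]. *)
exists (p ^+ i * x * z), (c * x * z + b * x * t + y * b * z + p ^+ j * y * t).
congr pair; first by rewrite /=; ring.
rewrite /= !mulrDr; have -> : p ^+ j * (c * x * z) = (p ^+ j * c) * x * z by ring.
by rewrite bc; ring.
Qed.

Lemma hermite_lattice_transversal i j b (S T : seq R) :
  is_transversal_mod (pideal (p ^+ i)) S ->
  is_transversal_mod (pideal (p ^+ j)) T ->
  is_transversal_mod (hermite_lattice i j b)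
    [seq ((s : R^o), (t : R^o)) | s <- S, t <- T].
Proof.
move=> [uS surS injS] [uT surT injT].
split=> [|[x y]|_ _ /allpairsP[[s t] /= [sS tT ->]] /allpairsP[[s' t'] /= [sS' tT' ->]]].
- by apply: allpairs_uniq => // -[s t] [s' t'] _ _ /= [-> ->].
(* Reducing the first coordinate subtracts [u] times [(p ^+ i, b)], which changes the second one by
   [b * u]. *)
- have [s sS [u _ xs]] := surS x; have [t tT [w _ yt]] := surT (y - b * u).
  exists (s, t); first by apply/allpairsP; exists (s, t).
  by exists u, w; congr pair; rewrite ?xs ?yt //=; ring.
- rewrite [X in hermite_lattice _ _ _ X](_ : _ = (s - s', t - t')) //.
  move=> [x [y [ss tt]]]; have E : s = s' by apply: injS => //; exists x.
  congr pair => //; apply: injT => //; apply/(hermite_lattice_snd i j b).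
  by exists x, y; rewrite -ss -tt E subrr.
Qed.

(** The first projection determines [i], the intersection with the second axis determines [j], and
    [(p ^+ i, b) - (p ^+ i, b')] lies on that axis. *)
Lemma hermite_lattice_inj i j j' i' b b' :
  hermite_lattice i j b = hermite_lattice i' j' b' ->
  [/\ i = i', j = j' & pideal (p ^+ j) (b - b')].
Proof.
move=> eqL.
have le_fst k l c k' l' c' :
    hermite_lattice k l c = hermite_lattice k' l' c' -> (k' <= k)%N.
  move=> E; have := hermite_lattice_gen1 k l c; rewrite E => -[x [y [kE _]]].
  by apply: (pideal_pow_pow p_unif); rewrite kE; apply: pidealM.
have le_snd k l c k' l' c' :
    hermite_lattice k l c = hermite_lattice k' l' c' -> (l' <= l)%N.
  move=> E; apply: (pideal_pow_pow p_unif); apply/(hermite_lattice_snd k' _ c').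
  by rewrite -E; apply/hermite_lattice_snd; exists 1; rewrite ?mulr1.
have ii : i = i'.
  by apply/eqP; rewrite eqn_leq (le_fst _ _ _ _ _ _ eqL) (le_fst _ _ _ _ _ _ (esym eqL)).
have jj : j = j'.
  by apply/eqP; rewrite eqn_leq (le_snd _ _ _ _ _ _ eqL) (le_snd _ _ _ _ _ _ (esym eqL)).
split=> //; apply/(hermite_lattice_snd i j b).
have g1 := hermite_lattice_gen1 i j b.
have g2 : hermite_lattice i j b (p ^+ i, b').
  by rewrite eqL ii; apply: hermite_lattice_gen1.
have := (hermite_lattice_subgroup i j b).2 _ _ g1 g2.
by rewrite [X in hermite_lattice _ _ _ X](_ : _ = (p ^+ i - p ^+ i, b - b')) // subrr.
Qed.

(* By pigeonhole [L] contains some [p^k (1 - p^d) *: v], and [1 - p^d] is a unit. *)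
Lemma submod_contains_pow L (v : R2) : GRing.submod_closed [in L] ->
  finite_set (cosets L) -> exists n, L (p ^+ n *: v).
Proof.
move=> Lsub finL; have [/set_mem L0 Llin] := Lsub.
have sL : is_subgroup L.
  split=> // x y /mem_set Lx /mem_set Ly.
  by rewrite addrC -scaleN1r; apply/set_mem/Llin.
have [S [uS surS _]] := transversal_exists sL finL.
have /choice[f fP] : forall k, exists s, s \in S /\ L (p ^+ k *: v - s).
  by move=> k; have [s] := surS (p ^+ k *: v); exists s.
have /(uniqPn 0)[k [l [kl]]] : ~~ uniq (map f (iota 0 (size S).+1)).
  apply/negP => uf; have /(uniq_leq_size uf) : {subset map f (iota 0 (size S).+1) <= S}.
    by move=> _ /mapP[k _ ->]; case: (fP k).
  by rewrite size_map size_iota ltnn.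
rewrite size_map size_iota => lS.
have kS := ltn_trans kl lS.
rewrite !(nth_map 0%N) ?size_iota// !nth_iota// !add0n => fkl.
exists k; have [[_ Lk] [_ Ll]] := (fP k, fP l).
have := subgroup_trans sL Lk (subgroup_subC sL (y := f k) _).
move=> /(_ (p ^+ l *: v)); rewrite {1}fkl => /(_ Ll) /mem_set Lkl.
have U := uniformizer_unit1B p_unif (etrans (subn_gt0 k l) kl).
have /set_mem := Llin (1 - p ^+ (l - k))^-1 _ _ Lkl (mem_set L0).
rewrite addr0 -scalerBl scalerA.
have -> : p ^+ k - p ^+ l = (1 - p ^+ (l - k)) * p ^+ k.
  by rewrite mulrBl mul1r -exprD subnK// ltnW.
by rewrite mulKr.
Qed.

(** The first projection [I] of [L] and its intersection [J] with the second axis are ideals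
    containing a power of [p], hence generated by some [p ^+ i] and [p ^+ j]. If [(p ^+ i, b)] lifts
    the generator of [I], subtracting a multiple of it brings any vector of [L] onto the second
    axis. *)
Lemma finite_index_submod_hermite L : GRing.submod_closed [in L] ->
  finite_set (cosets L) -> exists i j b, L = hermite_lattice i j b.
Proof.
move=> Lsub finL; have [/set_mem L0 Llin] := Lsub.
pose I : set R := [set x | exists y, L (x, y)].
pose J : set R := [set y | L (0, y)].
have [i Ii] : exists i, I = pideal (p ^+ i).
  have [n Ln] := submod_contains_pow (1, 1) Lsub finL.
  apply: (@ideal_containing_pow _ _ p_unif I n).
    split; first by exists 0.
    move=> a x y [x' /mem_set Lx] [y' /mem_set Ly].
    by exists (a * x' + y'); apply/set_mem/(Llin a (x, x') (y, y')).
  by exists (p ^+ n); move: Ln; congr (L (_, _)); rewrite /GRing.scale /= mulr1.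
have [j Jj] : exists j, J = pideal (p ^+ j).
  have [n Ln] := submod_contains_pow (0, 1) Lsub finL.
  apply: (@ideal_containing_pow _ _ p_unif J n).
    split=> // a x y /mem_set Lx /mem_set Ly.
    have /set_mem := Llin a (0, x) (0, y) Lx Ly.
    by congr (L (_, _)); rewrite /= /GRing.scale /= mulr0 addr0.
  by move: Ln; congr (L (_, _)); rewrite /GRing.scale /= ?mulr1 ?mulr0.
have [b Lb] : I (p ^+ i) by rewrite Ii; exists 1; rewrite ?mulr1.
exists i, j, b; apply/seteqP; split=> [[x y] Lxy|_ [x [y ->]]].
  have [z _ xz] : pideal (p ^+ i) x by rewrite -Ii; exists y.
  have : J (y - b * z).
    have /set_mem := Llin (- z) _ _ (mem_set Lb) (mem_set Lxy).
    by congr (L (_, _)); rewrite /= /GRing.scale /= -?xz; ring.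
  by rewrite Jj => -[t _ yt]; exists z, t; rewrite xz yt addrC subrK.
have : J (p ^+ j * y) by rewrite Jj; apply: pidealM.
move=> /mem_set Lj; have /set_mem := Llin x _ _ (mem_set Lb) Lj.
by congr (L (_, _)); rewrite /= /GRing.scale /=; ring.
Qed.

End HermiteLattice.

(** * Power series and the recurrence *)

Lemma fps_mul_cancelr (f h g : fps) :
  g 0%N != 0 -> fps_mul f g = fps_mul h g -> f = h.
Proof.
move=> g0 fh; apply/funext => n; elim/ltn_ind: n => n IHn.
have := congr1 (fun e : fps => e n) fh.
rewrite /fps_mul !big_ord_recr /= subnn => E; apply: (mulIf g0).
rewrite (eq_bigr (fun i : 'I_n => h i * g (n - i)%N)) in E; first by move/addrI: E => /=.
by move=> i _; rewrite IHn.
Qed.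

(** Truncating [f] after degree [n] turns the coefficient into one of a product of polynomials. *)
Lemma fps_mul_poly (f : fps) (g : {poly rat}) n :
  fps_mul f (fps_of_poly g) n = (\poly_(i < n.+1) f i * g)`_n.
Proof.
rewrite coefM; apply: eq_bigr => i _.
by rewrite coef_poly ltn_ord.
Qed.

Lemma fps_div_of_recurrence (q : nat) (a : nat -> nat) :
  a 0 = 1%N -> a 1 = 3%N -> a 2 = 4%N ->
  (forall n, a n.+3 = q * a n + 4)%N ->
  (fun n => (a n)%:R) =
    fps_div (fps_of_poly ((1 + 'X) ^+ 2))
            (fps_of_poly ((1 - 'X) * (1 - q%:R *: 'X^3))).
Proof.
move=> a0 a1 a2 a3; set g := _ * _.
have gE : g = 1 - 'X - q%:R *: 'X^3 + q%:R *: 'X^4.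
  rewrite /g mulrBr mulr1 mulrBl mul1r -scalerAr -exprS.
  by rewrite opprB addrA addrAC.
have g0 : fps_of_poly g 0%N != 0.
  by rewrite /fps_of_poly gE !(coefE, coefXn) /= !mulr0 ?subr0 ?addr0.
apply: (fps_mul_cancelr g0); rewrite fps_divK//.
apply/funext => n; rewrite fps_mul_poly gE /fps_of_poly.
set P := \poly_(i < _) _.
have -> : P * (1 - 'X - q%:R *: 'X^3 + q%:R *: 'X^4) =
    P - P * 'X^1 - q%:R *: (P * 'X^3) + q%:R *: (P * 'X^4).
  by rewrite mulrDr !mulrBr mulr1 -!scalerAr expr1.
have -> : (1 + 'X) ^+ 2 = 1 + 'X *+ 2 + 'X^2 :> {poly rat}.
  by rewrite sqrrD expr1n mul1r.
rewrite !(coefD, coefN, coefZ, coefMXn, coefMn, coefX, coefXn, coef1).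
have Pk k : (k <= n)%N -> P`_k = (a k)%:R by rewrite coef_poly ltnS => ->.
rewrite !Pk ?leq_subr//.
(* The degrees up to 2 use the initial values and degree 3 uses the recurrence once. From degree 4
   on, two consecutive instances of it are subtracted and the constants 4 cancel. *)
case: n {P Pk} => [|[|[|[|n]]]] /=; rewrite ?subSS ?subn0.
- by rewrite a0; ring.
- by rewrite a0 a1; ring.
- by rewrite a1 a2; ring.
- by rewrite a2 (a3 0%N) a0; ring.
- by rewrite (a3 n) (a3 n.+1) !natrD !natrM; ring.
Qed.

(** * Enumerating the subalgebras of given index *)

Lemma uniformizer_transversals (R : idomainType) (p : R) (S1 : seq R) n :
  is_uniformizer p -> is_transversal_mod (pideal p) S1 ->
  exists2 S, is_transversal_mod (pideal (p ^+ n)) S & size S = (size S1 ^ n)%N.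
Proof.
move=> p_unif trS1; elim: n => [|n [S trS sizeS]].
  by exists [:: 0] => //; exact: transversal_pow0.
rewrite -[p]expr1 in trS1; rewrite -addn1.
exists [seq s + p ^+ n * t | s <- S, t <- S1]; first exact: transversal_powD.
by rewrite size_allpairs sizeS expnD expn1.
Qed.

Section SubalgebraCount.
Context (R : idomainType) (p : R) (p_unif : is_uniformizer p).
Context (q : nat) (q_gt1 : (1 < q)%N) (T : nat -> seq R).
Context (trT : forall n, is_transversal_mod (pideal (p ^+ n)) (T n)).
Context (sizeT : forall n, size (T n) = (q ^ n)%N).
Implicit Type L : set (R^o * R^o).

Lemma coset_index_hermite i j b :
  coset_index (hermite_lattice p i j b) = (q ^ (i + j))%N.
Proof.
have trL := hermite_lattice_transversal p_unif b (trT i) (trT j).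
rewrite (coset_index_transversal (hermite_lattice_subgroup p i j b) trL).
by rewrite size_allpairs !sizeT expnD.
Qed.

Lemma hermite_lattice_subalgebra i j b :
  is_subalgebra2 (hermite_lattice p i j b) <-> is_good p i j b.
Proof.
split=> [[_ mulL _]|good]; first exact/hermite_lattice_mul.
split; [exact: hermite_lattice_submod|exact/hermite_lattice_mul|].
apply: finite_cosets_transversal; first exact: hermite_lattice_subgroup.
exact: (hermite_lattice_transversal p_unif b (trT i) (trT j)).
Qed.

Lemma hermite_lattice_mod i j b c : pideal (p ^+ j) (b - c) ->
  hermite_lattice p i j b = hermite_lattice p i j c.
Proof.
wlog suff sub : b c / pideal (p ^+ j) (b - c) ->
    hermite_lattice p i j b `<=` hermite_lattice p i j c.
  by move=> bc; apply/seteqP; split; apply: sub => //;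
    apply: subgroup_subC => //; exact: pideal_subgroup.
move=> [z _ bc] _ [x [y ->]]; exists x, (z * x + y); congr pair.
by rewrite mulrDr mulrA bc; ring.
Qed.

Lemma subalgebra2_hermite L : is_subalgebra2 L ->
  exists i j b, [/\ b \in T j, is_good p i j b & L = hermite_lattice p i j b].
Proof.
move=> subL; have [Lsub _ finL] := subL.
have [i [j [b Lb]]] := finite_index_submod_hermite p_unif Lsub finL.
have [_ surT _] := trT j; have [c cT bc] := surT b.
have Lc : L = hermite_lattice p i j c by rewrite Lb; exact: hermite_lattice_mod.
by exists i, j, c; split=> //; apply/hermite_lattice_subalgebra; rewrite -Lc.
Qed.

(** Here [k] is the exponent of the index [q ^ k]; the diagonal exponents are [i] and [k - i]. *)
Definition subalgebras_of_coindex k : seq (set (R^o * R^o)) :=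
  [seq hermite_lattice p i (k - i) b
     | i <- iota 0 k.+1, b <- [seq b <- T (k - i) | is_good p i (k - i) b]].

Lemma subalgebras_of_coindexP k L :
  L \in subalgebras_of_coindex k <-> is_subalgebra2 L /\ coset_index L = (q ^ k)%N.
Proof.
split=> [/allpairsPdep[i [b []]]|[/subalgebra2_hermite[i [j [b [bT good ->]]]]]].
  rewrite mem_iota mem_filter add0n ltnS => ik /andP[good bT] ->.
  by rewrite coset_index_hermite subnKC//; split=> //; apply/hermite_lattice_subalgebra.
(* Since [1 < q], the index [q ^ (i + j)] determines [i + j]. *)
rewrite coset_index_hermite => /(expnI q_gt1) <-; apply/allpairsPdep.
by exists i, b; rewrite mem_iota mem_filter add0n ltnS leq_addr addKn good bT.
Qed.

Lemma subalgebras_of_coindex_uniq k : uniq (subalgebras_of_coindex k).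
Proof.
apply: allpairs_uniq_dep => [|i _|]; first exact: iota_uniq.
  by apply: filter_uniq; case: (trT (k - i)%N).
move=> _ _ /allpairsPdep[i [b [_ bT ->]]] /allpairsPdep[i' [b' [_ bT' ->]]] /=.
move=> /(hermite_lattice_inj p_unif) [ii _ bb].
rewrite -ii in bT' *; have [_ _ injT] := trT (k - i)%N.
move: bT bT'; rewrite !mem_filter => /andP[_ bT] /andP[_ bT'].
by rewrite (injT _ _ bT bT' bb).
Qed.

Lemma size_subalgebras_of_coindex k :
  size (subalgebras_of_coindex k) =
  (\sum_(i < k.+1) count (is_good p i (k - i)) (T (k - i)))%N.
Proof.
rewrite size_allpairs_dep sumnE big_map.
rewrite -(big_mkord xpredT (fun i => count (is_good p i (k - i)) (T (k - i)))).
by rewrite /index_iota subn0; apply: eq_bigr => i _; rewrite size_filter.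
Qed.

(** Among subalgebras, the summand is 1 on the list and 0 off it, so the support is finite and the
    sum counts the list. *)
Lemma Xi2_subalgebras k : Xi2 R q k = (size (subalgebras_of_coindex k))%:R.
Proof.
rewrite /Xi2; transitivity (\sum_(L \in [set` subalgebras_of_coindex k]) (1 : rat)).
  rewrite -(fsbig_widen [set` subalgebras_of_coindex k]).
  - apply: eq_fsbigr => L /set_mem /= /subalgebras_of_coindexP[_ Lk].
    by rewrite /pow_Ns Lk eqxx.
  - by move=> L /= /subalgebras_of_coindexP[].
  - move=> L [/= Lsub nL]; rewrite /pow_Ns; case: eqP => //= Lk.
    by case: nL; apply/subalgebras_of_coindexP.
by rewrite -fsbig_seq ?subalgebras_of_coindex_uniq//;
  rewrite big_const_seq iter_addr_0 count_predT.
Qed.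

Lemma size_subalgebras_of_coindexSSS n :
  size (subalgebras_of_coindex n.+3) = (q * size (subalgebras_of_coindex n) + 4)%N.
Proof.
(* The terms of index 0, [n.+2] and [n.+3] are split off; they equal 2, 1 and 1. The terms in
   between are [q] times those of the sum for [n]. *)
rewrite !size_subalgebras_of_coindex big_ord_recl big_ord_recr big_ord_recr /=.
have tr1 : is_transversal_mod (pideal p) (T 1) by rewrite -[p]expr1.
rewrite /bump !add1n !subSS subn0 subnn subSnn.
rewrite (count_good_0S p_unif (trT _)) (count_good_pow1 p_unif _ (trT _)).
rewrite (count_good_pow0 _ (trT _)) big_distrr /=.
rewrite [X in (_ + (X + _ + _))%N](eq_bigr (fun i : 'I_n.+1 =>
  q * count (is_good p i (n - i)) (T (n - i)))%N); last first.
  move=> i _; have le_in : (i <= n)%N by rewrite -ltnS.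
  rewrite ?add1n ?subSS (subSn (leqW le_in)) (subSn le_in).
  by rewrite (count_goodSS p_unif i tr1 (trT (n - i)%N) (trT _)) sizeT expn1.
by rewrite addnC -!addnA.
Qed.

Lemma size_subalgebras_of_coindex_lt3 :
  [/\ size (subalgebras_of_coindex 0) = 1%N,
      size (subalgebras_of_coindex 1) = 3%N
    & size (subalgebras_of_coindex 2) = 4%N].
Proof.
split; rewrite size_subalgebras_of_coindex !big_ord_recr big_ord0 /=;
  rewrite ?subn0 ?subnn ?subSnn.
- by rewrite (count_good_pow0 _ (trT _)).
- by rewrite (count_good_pow0 _ (trT _)) (count_good_0S p_unif (trT _)).
- rewrite (count_good_pow0 _ (trT _)) (count_good_0S p_unif (trT _)).
  by rewrite (count_good_pow1 p_unif _ (trT _)).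
Qed.

End SubalgebraCount.

Theorem mainTheorem4 (R : idomainType) (m : set R) (q : nat)
    (dvrR : is_dvr m)
    (compactR : compact [set: adic m])
    (residue_card : (cosets m #= `I_q)%card) :
  [/\ (* every term of the sum is a power of q^-s *)
      forall L : set (R^o * R^o), is_subalgebra2 L ->
        exists k : nat, coset_index L = (q ^ k)%N,
      (* the sum is well defined as a formal power series *)
      forall k : nat, finite_set
        [set L : set (R^o * R^o) | is_subalgebra2 L /\ coset_index L = (q ^ k)%N]
    & Xi2 R q =
        fps_div (fps_of_poly ((1 + 'X) ^+ 2))
                (fps_of_poly ((1 - 'X) * (1 - q%:R *: 'X^3)))].
Proof.
have [p mE p_unif] := dvr_uniformizer dvrR; rewrite mE in residue_card.
have sp := pideal_subgroup p.
have [S1 trS1] : exists S, is_transversal_mod (pideal p) S.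
  by apply: transversal_exists => //; apply/finite_setP; exists q.
have sizeS1 : size S1 = q.
  by rewrite -(coset_index_transversal sp trS1); exact: card_fset_set.
(* The classes of 0 and 1 modulo [p] are distinct, since [p] does not divide 1. *)
have q_gt1 : (1 < q)%N.
  rewrite -sizeS1; have [_ surS1 _] := trS1.
  have [s sS ps] := surS1 0; have [t tS pt] := surS1 1.
  rewrite ltnNge; apply/negP => sizeS.
  have st : s = t.
    by case: (S1) sizeS sS tS => [|x []]//; rewrite !inE => _ /eqP-> /eqP->.
  have := sp.2 _ _ pt ps;
    rewrite st (_ : 1 - t - (0 - t) = 1); last by ring.
  move=> /(uniformizer_Nunit p_unif)/negP; apply; exact: unitr1.
have /choice[T TP] : forall n, exists S,
    is_transversal_mod (pideal (p ^+ n)) S /\ size S = (q ^ n)%N.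
  move=> n; have [S] := uniformizer_transversals n p_unif trS1.
  by rewrite sizeS1; exists S.
have trT n := (TP n).1; have sizeT n := (TP n).2.
split=> [L /(subalgebra2_hermite p_unif trT)[i [j [b [_ _ ->]]]]|k|].
- by exists (i + j)%N; exact: coset_index_hermite.
- rewrite [X in finite_set X](_ : _ = [set` subalgebras_of_coindex p T k])//.
  by apply/seteqP; split=> L /(subalgebras_of_coindexP p_unif q_gt1 trT sizeT).
have [a0 a1 a2] := size_subalgebras_of_coindex_lt3 p_unif trT.
pose a k := size (subalgebras_of_coindex p T k).
rewrite -(@fps_div_of_recurrence q a a0 a1 a2).
  by apply/funext => k; exact: Xi2_subalgebras.
by move=> n; exact: size_subalgebras_of_coindexSSS.
Qed.
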